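(* Let $k$ be a field, let $E$ and $A$ be sets, and let $f\colon E\to k^A$ be a thin family. Let $D_f$ be the set of thin dependences of $f$, and define $\overline f\colon E\to k^{D_f}$ by $\overline f(e)(d):=d(e)$ for $e\in E$ and $d\in D_f$. Then $$M_{ts}(f)=M^*(\overline f),$$ where $M^*(\overline f)$ is the dual of the representable matroid $M(\overline f)$. In particular $M_{ts}(f)$ is a cofinitary matroid.
   Context: A matroid $M$ consists of a (possibly infinite) ground set $E$ and a set $\mathcal I$ of subsets of $E$ (the independent sets) such that: (I1) $\emptyset\in\mathcal I$; (I2) $\mathcal I$ is closed under taking subsets; (I3) for every non-maximal $I\in\mathcal I$ and every maximal $I'\in\mathcal I$ there is $x\in I'\setminus I$ with $I\cup\{x\}\in\mathcal I$; (IM) whenever $I\subseteq X\subseteq E$ and $I\in\mathcal I$, the set $\{I'\in\mathcal I : I\subseteq I'\subseteq X\}$ has a maximal element. Bases are maximal independent sets; circuits are minimal dependent sets. The dual $M^*$ is the matroid on $E$ whose bases are the complements of the bases of $M$. A matroid is finitary if all its circuits are finite, and cofinitary if its dual is finitary. For a vector space $V$ over $k$ and a map $\phi\colon E\to V$, a linear dependence of $\phi$ is a map $c\colon E\to k$ with $\sum_{e\in E}c(e)\phi(e)=0$, including the requirement that only finitely many summands are nonzero. $M(\phi)$ is the matroid on $E$ in which $E'\subseteq E$ is independent iff there is no nonzero linear dependence of $\phi$ that is zero outside $E'$. A thin dependence of $f\colon E\to k^A$ is a map $c\colon E\to k$ such that for each $a\in A$ we have $\sum_{e\in E}c(e)f(e)(a)=0$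 (including the requirement that, for each $a$, only finitely many summands are nonzero). The thin sums system $M_{ts}(f)$ is the set system on $E$ in which a subset is independent iff there is no nonzero thin dependence of $f$ that is zero outside that subset. The family $f$ is thin if for each $a\in A$ there are only finitely many $e\in E$ with $f(e)(a)\neq 0$. *)

(* Defs.v *)
From HB Require Import structures.
From mathcomp Require Import all_boot all_algebra.
From mathcomp Require Import boolp classical_sets functions cardinality fsbigop.

Set Implicit Arguments.
Unset Strict Implicit.
Unset Printing Implicit Defensive.

Import GRing.Theory.

Local Open Scope classical_set_scope.
Local Open Scope ring_scope.

(* A set system on a possibly infinite ground set [E] is given by its family
   of independent sets, of type [set (set E)]; the ground set is the whole
   type. *)
Section SetSystems.
Variable E : Type.
Implicit Types (F S : set (set E)) (I J X : set E).

Definition maximal_in F : set (set E) :=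
  [set X | F X /\ forall Y, F Y -> X `<=` Y -> Y = X].

Definition minimal_in F : set (set E) :=
  [set X | F X /\ forall Y, F Y -> Y `<=` X -> Y = X].

Definition bases S := maximal_in S.

Definition circuits S := minimal_in (~` S).

Record is_matroid S : Prop := IsMatroid {
  matroid_I1 : S set0;
  matroid_I2 : forall I J, S J -> I `<=` J -> S I;
  matroid_I3 : forall I J, S I -> ~ maximal_in S I -> maximal_in S J ->
    exists x, [/\ J x, ~ I x & S (I `|` [set x])];
  matroid_IM : forall I X, S I -> I `<=` X ->
    maximal_in [set J | [/\ S J, I `<=` J & J `<=` X]] !=set0
}.

(* The independent sets of the dual: subsets of complements of bases.  By
   [bases_dual] below, the bases of the dual are exactly these complements. *)
Definition dual S : set (set E) :=
  [set I | exists2 B, bases S B & I `<=` ~` B].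

Definition finitary S := circuits S `<=` finite_set.

Definition cofinitary S := finitary (dual S).

Lemma bases_dual S : bases (dual S) = [set ~` B | B in bases S].
Proof.
apply/seteqP; split=> [X [[B bB XB] Xmax]|_ [B bB <-]].
  by exists B => //; apply: Xmax => //; exists B.
split; first by exists B.
move=> Y [C bC YC] BY; apply/seteqP; split=> //.
have CB : C `<=` B by rewrite -[C]setCK -[B]setCK; exact/subsetC/(subset_trans BY).
by rewrite (bC.2 _ bB.1 CB).
Qed.

End SetSystems.

(* [\sum_(e \in _)] is 0 by convention when the support of the summands is
   infinite, so finiteness has to be required separately. *)
Definition fin_sum_eq0 (E : choiceType) (V : nmodType) (g : E -> V) : Prop :=
  finite_set [set e | g e != 0] /\ \sum_(e \in [set: E]) g e = 0.

Section Dependences.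
Variables (k : fieldType) (E : choiceType).

Definition system_of_dependences (D : set (E -> k)) : set (set E) :=
  [set X | ~ exists c : E -> k,
     [/\ D c, c <> cst 0 & forall e, ~ X e -> c e = 0]].

Definition linear_dependences (V : lmodType k) (phi : E -> V) : set (E -> k) :=
  [set c | fin_sum_eq0 (fun e => c e *: phi e)].

Definition representable_matroid (V : lmodType k) (phi : E -> V) :=
  system_of_dependences (linear_dependences phi).

Variable A : Type.
Implicit Type f : E -> (A -> k).

Definition thin f : Prop := forall a, finite_set [set e | f e a != 0].

Definition thin_dependences f : set (E -> k) :=
  [set c | forall a, fin_sum_eq0 (fun e => c e * f e a)].

Definition thin_sums_system f := system_of_dependences (thin_dependences f).

(* The codomain is [k^o] rather than [k] so that [k^(D_f)] carries its
   pointwise [k]-vector space structure. *)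
Definition overline f (e : E) : set_type (thin_dependences f) -> k^o :=
  fun d => \val d e.

End Dependences.

Arguments overline {k E A} f e _.

(* Main.v *)
Require Import Defs.
From mathcomp Require Import all_boot all_algebra.
From mathcomp Require Import boolp classical_sets functions cardinality fsbigop.
From mathcomp Require Import finmap.

Set Implicit Arguments.
Unset Strict Implicit.
Unset Printing Implicit Defensive.

Import GRing.Theory.

(** Write [<c, d>] for the sum of the [c e * d e]; it makes sense whenever [c]
    is finitely supported.  Let [D] be the space of thin dependences of [f].
    A finitely supported [c] is a linear dependence of [overline f] exactly
    when [<c, d> = 0] for all [d] in [D].  Let [L] be the space of these [c].
    By definition [D] is orthogonal to [L].  Conversely, as [f] is thin, every
    row [f^~ a] is finitely supported; it is orthogonal to [D], because the
    elements of [D] satisfy the equation with index [a], so it lies in [L].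
    A function orthogonal to [L] is therefore orthogonal to all the rows, that
    is, it lies in [D].  Hence [D] is the annihilator of [L]
    ([thin_dependences_annihilator]).

    What remains is a statement about an arbitrary space [L] of finitely
    supported functions ([annihilator_dual]): the sets that support no nonzero
    function orthogonal to [L] are those that avoid some base [B] of the
    matroid of [L].  If [X] avoids [B], a function supported on [X] and
    orthogonal to [L] vanishes on [B], hence everywhere, since each point is
    tied to [B] by an element of [L].  If the complement of [X] contains no
    base, extend a maximal independent subset [B] of this complement to a base
    [B'] and take [b] in [B'] outside [B].  The fundamental cocircuit of [b]
    with respect to [B'] ([fundamental_cocircuit]) carries a function
    orthogonal to [L] with value 1 at [b]; it vanishes on [B], hence on the
    complement of [X], so [X] is not independent for the annihilator.

    The matroid axioms and cofinitarity then follow from general facts: the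
    matroid of [L] is a finitary matroid ([finsupp_subspace_matroid],
    [finsupp_subspace_finitary]), duals of matroids are matroids
    ([dual_is_matroid]) and duality is an involution ([dual_dual]). *)

Local Open Scope classical_set_scope.
Local Open Scope ring_scope.

(** * Duality of matroids *)

Section MatroidDuality.
Variables (E : Type) (S : set (set E)).
Implicit Types I J X B : set E.

Lemma maximal_setU1N (F : set (set E)) B x :
  maximal_in F B -> ~ B x -> ~ F (B `|` [set x]).
Proof.
move=> [_ Bmax] nBx FBx; apply: nBx.
by rewrite -(Bmax _ FBx (@subsetUl _ _ _)); right.
Qed.

Hypothesis mS : is_matroid S.

Lemma exists_base : bases S !=set0.
Proof.
have [B [[SB _ _] Bmax]] := matroid_IM mS (matroid_I1 mS) (@sub0set _ setT).
by exists B; split=> // Y SY BY; apply: Bmax => //; split.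
Qed.

(** A nonmaximal [J] could be augmented by (I3) from the base [B] without
    leaving [X]. *)
Lemma maximal_in_spanning_base I J X B : bases S B -> B `<=` X ->
  maximal_in [set J | [/\ S J, I `<=` J & J `<=` X]] J -> bases S J.
Proof.
move=> bB BX [[SJ IJ JX] Jmax]; apply: contrapT => nbJ.
have [x [Bx nJx SJx]] := matroid_I3 mS SJ nbJ bB.
apply: nJx; rewrite -(Jmax (J `|` [set x])); last by move=> y; left.
  by right.
split=> //; first by move=> y /IJ; left.
by move=> y [/JX//|->]; apply: BX.
Qed.

Lemma dual_dual : dual (dual S) = S.
Proof.
apply/seteqP; split=> I.
  move=> [B']; rewrite bases_dual => -[B [SB _] <-]; rewrite setCK.
  exact: (matroid_I2 mS).
move=> SI; have [B Bmax] := matroid_IM mS SI (@subsetT _ I).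
have [B0 bB0] := exists_base.
have bB : bases S B := maximal_in_spanning_base bB0 (@subsetT _ _) Bmax.
by exists (~` B); rewrite ?bases_dual ?setCK; [exists B|case: Bmax => -[]].
Qed.

(** For the exchange axiom, extend [B' \ I] to a base [B1] that avoids [I]; if
    no further element of the complement of [B'] could be added to [I], then
    [B1] would contain everything outside [I], and [I] would be a base of the
    dual.
    For the maximality axiom, take a base [B1] avoiding [I] that meets the
    complement of [X] in a maximal independent set [B0]; then [X \ B1] is
    maximal, since for a larger set, avoiding a base [B2], exchange from [B2]
    into [B1] minus a point would enlarge [B0]. *)
Lemma dual_is_matroid : is_matroid (dual S).
Proof.
split.
- by have [B bB] := exists_base; exists B.
- by move=> I J [B bB JB] IJ; exists B => //; apply: subset_trans JB.
- move=> I J [B bB IB] nmaxI; rewrite -/(bases _) bases_dual => -[B' bB' <-].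
  apply: contrapT => noexch.
  have SI : S (B' `\` I) by apply: (matroid_I2 mS bB'.1) => x [].
  have [|B1 maxB1] := matroid_IM mS SI (_ : _ `<=` ~` I); first by move=> x [].
  have bB1 : bases S B1.
    apply: (maximal_in_spanning_base bB _ maxB1).
    by move=> x Bx Ix; exact: IB Bx.
  have [[_ B'B1 B1I] _] := maxB1.
  have B1E : ~` B1 = I.
    apply/seteqP; split=> x; last by move=> Ix /B1I; exact.
    move=> nB1x; apply: contrapT => nIx.
    have nB'x : ~ B' x by move=> B'x; apply: nB1x; apply: B'B1.
    apply: noexch; exists x; split=> //; exists B1 => // y [Iy /B1I|->]//.
  by apply: nmaxI; rewrite -/(bases _) bases_dual -B1E; exists B1.
- move=> I X [B bB IB] IX.
  have [B0 [[SB0 _ B0X] B0max]] :=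
    matroid_IM mS (matroid_I1 mS) (@sub0set _ (~` X)).
  have B0I : B0 `<=` ~` I by move=> x /B0X nXx /IX.
  have [B1 maxB1] := matroid_IM mS SB0 B0I.
  have bB1 : bases S B1.
    apply: (maximal_in_spanning_base bB _ maxB1).
    by move=> x Bx Ix; exact: IB Bx.
  have [[SB1 B0B1 B1I] _] := maxB1.
  exists (X `\` B1); split.
    split; first by exists B1 => // x [].
      by move=> x Ix; split; [exact: IX|move=> /B1I].
    by move=> x [].
  move=> J [[B2 bB2 JB2] IJ JX] XB1J; apply/seteqP; split=> // y Jy.
  split; first exact: JX.
  move=> B1y.
  have SB1y : S (B1 `\ y) by apply: (matroid_I2 mS SB1) => z [].
  have nb : ~ bases S (B1 `\ y).
    have nB1y : ~ (B1 `\ y) y by move=> [_ ]; apply.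
    move=> bB1y; apply: (maximal_setU1N bB1y nB1y).
    by apply: (matroid_I2 mS SB1) => z [[]|->].
  have [x [B2x nB1x Sx]] := matroid_I3 mS SB1y nb bB2.
  have xy : x <> y by move=> xy; apply: (JB2 y) => //; rewrite -xy.
  have nB1x' : ~ B1 x by move=> B1x; apply: nB1x.
  have nXx : ~ X x by move=> Xx; apply: (JB2 x) => //; apply: XB1J.
  have nB0x : ~ B0 x by move=> /B0B1.
  apply: nB0x; rewrite -(B0max (B0 `|` [set x])); first by right.
    split=> //; last by move=> z [/B0X//|->].
    apply: (matroid_I2 mS Sx) => z [B0z|->]; last by right.
    left; split; first exact: B0B1.
    by move=> /= zy; apply: (B0X z B0z); rewrite zy; apply: JX.
  by move=> z; left.
Qed.

End MatroidDuality.

(** * Matroids of spaces of finitely supported functions *)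

(** Used to see that dependence passes from a union of a chain to one of its
    members: this is where finiteness of supports enters the maximality axiom. *)
Lemma finite_chain_cover (E : choiceType) (F : set (set E)) (I X : set E) :
  finite_set X -> total_on F subset -> X `<=` I `|` \bigcup_(Y in F) Y ->
  X `<=` I \/ exists2 Y, F Y & X `<=` I `|` Y.
Proof.
move=> /finite_seqP[r ->] Ftot.
elim: r => [_|x r IH rF]; first by left=> y; rewrite /= in_nil.
have {}IH := IH (fun y yr => rF y (mem_behead (s := x :: r) yr)).
have cons_sub Z : Z x -> [set` r] `<=` Z -> [set` x :: r] `<=` Z.
  by move=> Zx rZ y /=; rewrite inE => /orP[/eqP->//|/rZ].
have [Ix|[Y FY Yx]] := rF x (mem_head x r).
  case: IH => [rI|[Y FY rY]]; first by left; exact: cons_sub.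
  by right; exists Y => //; apply: cons_sub => //; left.
right; case: IH => [rI|[Z FZ rZ]].
  by exists Y => //; apply: cons_sub; [right|move=> y /rI; left].
case: (Ftot Y Z FY FZ) => [YZ|ZY].
  by exists Z => //; apply: cons_sub => //; right; exact: YZ.
exists Y => //; apply: cons_sub; first by right.
by move=> y /rZ[|/ZY]; [left|right].
Qed.

Section FinSuppSpace.
Variables (k : fieldType) (E : choiceType).
Implicit Types (L : set (E -> k)) (c d s : E -> k) (I X B Y : set E).

Record finsupp_subspace L : Prop := FinSuppSubspace {
  fss_finite : forall c, L c -> finite_set [set e | c e != 0];
  fss0 : L (cst 0);
  fss_linear : forall a u v, L u -> L v -> L (fun e => a * u e + v e)
}.

Definition pairing c d : k := \sum_(e \in [set: E]) c e * d e.

Definition annihilator L : set (E -> k) :=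
  [set d | forall c, L c -> pairing c d = 0].

Lemma pairing0 d : pairing (cst 0) d = 0.
Proof. by apply: fsbig1 => e _; rewrite mul0r. Qed.

Lemma pairing1 c d e : (forall x, x <> e -> c x * d x = 0) ->
  pairing c d = c e * d e.
Proof.
move=> cd0; rewrite -[RHS](fsbig_set1 +%R e (fun x => c x * d x)).
by apply/esym/fsbig_widen => // x [_ /cd0].
Qed.

Lemma pairing_linear a u v d :
  finite_set [set e | u e != 0] -> finite_set [set e | v e != 0] ->
  pairing (fun e => a * u e + v e) d = a * pairing u d + pairing v d.
Proof.
move=> finu finv; pose F := [set e | u e != 0] `|` [set e | v e != 0].
have finF : finite_set F by rewrite finite_setU.
have F0 x : ~ F x -> u x = 0 /\ v x = 0.
  by move=> nFx; split; apply: contrapT => /eqP ?; apply: nFx; [left|right].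
have pF w : (forall x, ~ F x -> w x = 0) ->
    pairing w d = \sum_(e \in F) w e * d e.
  by move=> w0; apply/esym/fsbig_widen => // x [_ /w0 /= ->]; rewrite mul0r.
rewrite !pF; try by move=> x /F0[ux vx]; rewrite ?ux ?vx ?mulr0 ?addr0.
rewrite mulr_fsumr -fsbig_split//; apply: eq_fsbigr => x _.
by rewrite mulrDl mulrA.
Qed.

(** Elimination inside this subspace keeps track of orthogonality to [d]. *)
Lemma finsupp_subspace_perp L d : finsupp_subspace L ->
  finsupp_subspace (L `&` [set c | pairing c d = 0]).
Proof.
move=> hL; split=> [c [/(fss_finite hL)]//||a u v [Lu u0] [Lv v0]].
  by split; [exact: fss0 hL|exact: pairing0].
split; first exact: fss_linear.
have /= -> := pairing_linear a d (fss_finite hL Lu) (fss_finite hL Lv).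
by rewrite u0 v0 mulr0 addr0.
Qed.

(** For [x] outside [I] this says that [x] lies in the closure of [I]; for [x]
    in [I] it is the stronger property that [x] lies on a circuit inside
    [I]. *)
Definition spanned L I x :=
  exists s, [/\ L s, s x = 1 & forall z, ~ I z -> z <> x -> s z = 0].

(** Gaussian elimination: subtracting multiples of the relations that span the
    points of [Y] clears [c] on [Y].  As [Y] misses [I], the relation of one
    point of [Y] vanishes at the others, so the points can be treated one at a
    time.  The function [c] may come from a space larger than [L]; when [c - s]
    turns out to be 0, it follows that [c] belongs to [L]. *)
Lemma eliminate_spanned L I Y c : finsupp_subspace L ->
    finite_set [set e | c e != 0] ->
    (forall x, Y x -> ~ I x) -> (forall x, Y x -> spanned L I x) ->
  exists s, [/\ L s, forall x, Y x -> s x = c x &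
    forall z, ~ I z -> ~ Y z -> s z = 0].
Proof.
move=> hL finc YI spY.
have [r suppr] : exists r : seq E, forall x, Y x -> c x != 0 -> x \in r.
  have [r rE] := (finite_seqP _).1 finc.
  by exists r => x _ cx0; have : [set` r] x by rewrite -rE.
elim: r => [|x r IH] in c finc suppr *.
  exists (cst 0); split=> // [|x Yx]; first exact: fss0 hL.
  by apply/esym/eqP; apply: contraT => /(suppr _ Yx).
have [Yx|nYx] := pselect (Y x); last first.
  apply: IH => // y Yy /(suppr _ Yy); rewrite inE => /orP[/eqP yx|//].
  by rewrite yx in Yy.
have [t [Lt tx t0]] := spY x Yx.
have [||s [Ls sc s0]] := IH (fun e => (- c x) * t e + c e).
- apply: (@sub_finite_set _ _ ([set e | t e != 0] `|` [set e | c e != 0])).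
    move=> e /=; have [->|] := eqVneq (t e) 0; last by left.
    by rewrite mulr0 add0r; right.
  by rewrite finite_setU; split=> //; apply: fss_finite Lt.
- move=> y Yy; have [->|/eqP yx] := eqVneq y x.
    by rewrite tx mulr1 addNr eqxx.
  rewrite (t0 y (YI _ Yy) yx) mulr0 add0r => /(suppr _ Yy).
  by rewrite inE => /orP[/eqP|].
exists (fun e => c x * t e + s e); split.
- exact: fss_linear.
- by move=> y Yy; rewrite sc// mulNr addrA addrN add0r.
- move=> z nIz nYz; rewrite s0// addr0 t0 ?mulr0// => zx.
  by apply: nYz; rewrite zx.
Qed.

Lemma independentP L X : system_of_dependences L X <->
  forall c, L c -> (forall e, ~ X e -> c e = 0) -> c = cst 0.
Proof.
split=> [SX c Lc cX|SX [c [Lc c0 cX]]]; last exact/c0/SX.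
by apply: contrapT => c0; apply: SX; exists c.
Qed.

Lemma independent_sub L I J :
  system_of_dependences L J -> I `<=` J -> system_of_dependences L I.
Proof.
move=> /independentP SJ IJ; apply/independentP => c Lc cI.
by apply: SJ => // e nJe; apply: cI => /IJ.
Qed.

Lemma dependent_spanned L I x : finsupp_subspace L ->
  system_of_dependences L I -> ~ system_of_dependences L (I `|` [set x]) ->
  spanned L I x.
Proof.
move=> hL /independentP SI /contrapT[c [Lc c0 cI]].
have cx0 : c x != 0.
  apply: contra_notT c0 => /negPn/eqP cx0; apply: SI => // e nIe.
  by have [->//|/eqP ex] := eqVneq e x; apply: cI => -[].
exists (fun e => (c x)^-1 * c e + cst 0 e); split.
- by apply: fss_linear => //; exact: fss0.
- by rewrite mulVf//= addr0.
- by move=> z nIz zx; rewrite (cI z) ?mulr0 ?addr0// => -[].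
Qed.

(** Only [x] contributes to the pairing of [d] with a relation that ties [x] to
    [I]. *)
Lemma spanned_eq0 L I x d : spanned L I x -> annihilator L d ->
  (forall e, I e -> d e = 0) -> d x = 0.
Proof.
move=> [s [Ls sx s0]] Ld dI; have := Ld s Ls.
rewrite (pairing1 (e := x)) ?sx ?mul1r// => y yx.
have [/dI->|nIy] := pselect (I y); first by rewrite mulr0.
by rewrite s0// mul0r.
Qed.

Section Matroid.
Variables (L : set (E -> k)) (hL : finsupp_subspace L).
Notation S := (system_of_dependences L).

Lemma independent_maximal I X : S I -> I `<=` X ->
  maximal_in [set J | [/\ S J, I `<=` J & J `<=` X]] !=set0.
Proof.
move=> SI IX.
have [F FP Ftot|J [[SJ JX] Jmax]] :=
  Zorn_bigcup (P := [set J | S (I `|` J) /\ I `|` J `<=` X]).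
  split; last by move=> x [/IX//|[Y /FP[_ YX] Yx]]; apply: YX; right.
  apply/independentP => c Lc c0.
  have suppF : [set e | c e != 0] `<=` I `|` \bigcup_(Y in F) Y.
    by move=> e /= ce; apply: contrapT => /c0/eqP; rewrite (negPf ce).
  have out Z : [set e | c e != 0] `<=` Z -> forall e, ~ Z e -> c e = 0.
    by move=> cZ e nZe; apply/eqP; apply: contraT => /cZ.
  have [cI|[Y FY cY]] := finite_chain_cover (fss_finite hL Lc) Ftot suppF.
    exact: (independentP L I).1 SI c Lc (out _ cI).
  exact: (independentP L _).1 (FP _ FY).1 c Lc (out _ cY).
exists (I `|` J); split; first by split=> // x; left.
move=> Y [SY IY YX] IJY; apply: contrapT => YIJ.
have IYE : I `|` Y = Y by apply/setUidPr.
apply: (Jmax Y); last by rewrite /= IYE.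
split; first by move=> x Jx; apply: IJY; right.
move=> YJ; apply: YIJ; apply/seteqP; split=> // x /YJ; by right.
Qed.

(** If no point of [J \ I] can be added to [I], then [I] spans [J \ I], hence
    everything, by eliminating [J \ I] from relations that tie points to the
    base [J]; so [I] is maximal. *)
Lemma independent_exchange I J : S I -> ~ maximal_in S I -> maximal_in S J ->
  exists x, [/\ J x, ~ I x & S (I `|` [set x])].
Proof.
move=> SI nImax Jmax; apply: contrapT => noexch; apply: nImax.
split=> // Y SY IY.
apply/seteqP; split=> // y Yy; apply: contrapT => nIy.
have spJ x : (J `\` I) x -> spanned L I x.
  move=> [Jx nIx]; apply: dependent_spanned => // SIx.
  by apply: noexch; exists x.
have [s [Ls sy s0]] : spanned L I y.
  have [Jy|nJy] := pselect (J y); first exact: spJ.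
  have [c [Lc cy c0]] := dependent_spanned hL Jmax.1 (maximal_setU1N Jmax nJy).
  have [s [Ls sJ s0]] := eliminate_spanned (Y := J `\` I) hL (fss_finite hL Lc)
    (fun x xJI => xJI.2) spJ.
  exists (fun e => (-1) * s e + c e); split; first exact: fss_linear.
    by rewrite s0 ?cy ?mulr0 ?add0r// => -[].
  move=> z nIz zy; have [Jz|nJz] := pselect (J z).
    by rewrite sJ// mulN1r addNr.
  by rewrite s0 ?c0 ?mulr0 ?addr0// => -[].
have s0' : s = cst 0.
  apply: ((independentP L Y).1 SY s Ls) => e nYe.
  by apply: s0 => [/IY//|ey]; apply: nYe; rewrite ey.
by move: sy; rewrite s0' => /esym/eqP; rewrite oner_eq0.
Qed.

Lemma finsupp_subspace_matroid : is_matroid S.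
Proof.
split.
- by apply/independentP => c Lc c0; apply/funext => e; apply: c0.
- by move=> I J SJ IJ; exact: independent_sub IJ.
- exact: independent_exchange.
- exact: independent_maximal.
Qed.

(** The support of a relation inside a circuit is dependent, so by minimality
    it is the whole circuit. *)
Lemma finsupp_subspace_finitary : finitary S.
Proof.
move=> C [/= /contrapT[c [Lc c0 cC]] Cmin].
rewrite -(Cmin [set e | c e != 0]); first exact: fss_finite Lc.
  by apply; exists c; split=> // e /negP/negPn/eqP.
by move=> e /= ce; apply: contrapT => /cC/eqP; rewrite (negPf ce).
Qed.

(** At a point [x] outside [B], the value has to be minus the coefficient of
    [b] in the relation that ties [x] to [B]; this makes [d] orthogonal to
    these relations.  They generate [L]: eliminating the complement of [B] from
    an element of [L] leaves a relation supported on [B], which is 0. *)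
Lemma fundamental_cocircuit B b : bases S B -> B b ->
  exists d, [/\ annihilator L d, d b = 1 & forall x, B x -> x <> b -> d x = 0].
Proof.
move=> bB Bb.
have spB x : exists s, ~ B x ->
    [/\ L s, s x = 1 & forall z, ~ B z -> z <> x -> s z = 0].
  have [Bx|nBx] := pselect (B x); first by exists (cst 0).
  by have [s hs] := dependent_spanned hL bB.1 (maximal_setU1N bB nBx); exists s.
have {spB}[sf sfP] := choice spB.
pose d x : k := if x == b then 1 else if `[< B x >] then 0 else - sf x b.
have db : d b = 1 by rewrite /d eqxx.
have dB x : B x -> x <> b -> d x = 0.
  by move=> Bx /eqP/negPf xb; rewrite /d xb asboolT.
exists d; split=> // c Lc.
(* The relations tying points to B lie in L and are orthogonal to d. *)
have spd x : (~` B) x -> spanned (L `&` [set c | pairing c d = 0]) B x.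
  move=> nBx; have [Ls sx s0] := sfP x nBx.
  exists (sf x); split=> //; split=> //=.
  have xb : x <> b by move=> xb; apply: nBx; rewrite xb.
  (* Only the coordinates x and b contribute to the pairing. *)
  rewrite /pairing -(@fsbig_widen _ _ _ _ [set x; b])//; last first.
    move=> z [_ /= /not_orP[zx zb]].
    have [Bz|nBz] := pselect (B z); first by rewrite dB// mulr0.
    by rewrite s0// mul0r.
  rewrite fsbigU0; [|exact: finite_set1|exact: finite_set1|].
    rewrite !fsbig_set1 sx db /d (negPf (introN eqP xb)) asboolF//.
    by rewrite /= mul1r mulr1 addNr.
  by move=> z [/= -> /xb].
(* Hence c agrees off B with some s in L orthogonal to d, and c = s as B is
   independent. *)
have [s [[Ls sd] sc s0]] := eliminate_spanned (finsupp_subspace_perp d hL)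
  (fss_finite hL Lc) (Y := ~` B) (fun x nBx => nBx) spd.
suff -> : c = s by [].
have cs0 : (fun e => (-1) * s e + c e) = cst 0.
  apply: ((independentP L B).1 bB.1); first exact: fss_linear.
  by move=> e nBe; rewrite sc// mulN1r addNr.
apply/funext => e; have /= := congr1 (@^~ e) cs0.
by rewrite mulN1r addrC => /eqP; rewrite subr_eq0 => /eqP.
Qed.

(** Both inclusions rest on [spanned_eq0]: a function orthogonal to [L] that
    vanishes on a set vanishes on its closure. *)
Lemma annihilator_dual : system_of_dependences (annihilator L) = dual S.
Proof.
apply/seteqP; split=> X; last first.
  move=> [B bB XB]; apply/independentP => d Ld dX; apply/funext => e.
  have dB x : B x -> d x = 0 by move=> Bx; apply: dX => /XB.
  have [/dB//|nBe] := pselect (B e).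
  apply: (@spanned_eq0 L B) => //.
  exact: (dependent_spanned hL bB.1 (maximal_setU1N bB nBe)).
move=> /independentP SX.
have mS := finsupp_subspace_matroid.
have [B [[SB _ BX] Bmax]] :=
  matroid_IM mS (matroid_I1 mS) (@sub0set _ (~` X)).
have [B' B'max] := matroid_IM mS SB (@subsetT _ B).
have [B0 bB0] := exists_base mS.
have bB' := maximal_in_spanning_base mS bB0 (@subsetT _ _) B'max.
have [[SB' BB' _] _] := B'max.
exists B; last by move=> x Xx /BX.
suff -> : B = B' by [].
apply/seteqP; split=> // b B'b; apply: contrapT => nBb.
have [d [Ld db d0]] := fundamental_cocircuit bB' B'b.
have dB x : B x -> d x = 0.
  by move=> Bx; apply: d0; [exact: BB'|move=> xb; apply: nBb; rewrite -xb].
suff d00 : d = cst 0 by move: db; rewrite d00 => /esym/eqP; rewrite oner_eq0.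
apply: SX => // e nXe; have [/dB//|nBe] := pselect (B e).
apply: (@spanned_eq0 L B) => //; apply: dependent_spanned => // SBe.
apply: nBe; rewrite -(Bmax (B `|` [set e])); first by right.
  by split=> // x [/BX//|->].
by move=> x; left.
Qed.

End Matroid.

End FinSuppSpace.

(** * Thin dependences as an annihilator *)

Section ThinSums.
Variables (k : fieldType) (E : choiceType).

(** In a linear dependence only the summands [c e *: phi e] are finitely many,
    so [c] may be nonzero at infinitely many zeros of [phi]; such dependences
    cannot be paired with arbitrary functions and are left out here. *)
Definition finite_dependences (V : lmodType k) (phi : E -> V) : set (E -> k) :=
  linear_dependences phi `&` [set c | finite_set [set e | c e != 0]].

Lemma sum_finsupp (V : lmodType k) (phi : E -> V) (c : E -> k) (F : set E) :
  finite_set F -> (forall e, ~ F e -> c e = 0) ->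
  \sum_(e \in [set: E]) c e *: phi e = \sum_(e <- fset_set F) c e *: phi e.
Proof.
move=> finF c0; apply: fsbigTE => e; rewrite in_fset_set// => eF.
by rewrite c0 ?scale0r// => Fe; move: eF; rewrite mem_set.
Qed.

Lemma finite_dependences_subspace (V : lmodType k) (phi : E -> V) :
  finsupp_subspace (finite_dependences phi).
Proof.
have fin_phi (c : E -> k) : finite_set [set e | c e != 0] ->
    finite_set [set e | c e *: phi e != 0].
  by apply: sub_finite_set => e /=; apply: contra_neq => ->; rewrite scale0r.
split=> [c []//||a u v [[_ u0] finu] [[_ v0] finv]].
  split; last by apply: (@sub_finite_set _ _ set0) => // e /=; rewrite eqxx.
  split; last by apply: fsbig1 => e _; rewrite scale0r.
  by apply: (@sub_finite_set _ _ set0) => // e /=; rewrite scale0r eqxx.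
pose F := [set e | u e != 0] `|` [set e | v e != 0].
have finF : finite_set F by rewrite finite_setU.
have uF e : ~ F e -> u e = 0.
  by move=> nF; apply/eqP; apply: contra_notT nF => ?; left.
have vF e : ~ F e -> v e = 0.
  by move=> nF; apply/eqP; apply: contra_notT nF => ?; right.
have wF e : ~ F e -> a * u e + v e = 0.
  by move=> nF; rewrite uF// vF// mulr0 addr0.
have finw : finite_set [set e | a * u e + v e != 0].
  by apply: sub_finite_set finF => e; apply: contra_neqP; exact: wF.
split=> //; split; first exact: fin_phi.
rewrite (sum_finsupp phi finF wF).
under eq_bigr => e _ do rewrite scalerDl -scalerA.
rewrite big_split/= -scaler_sumr.
by rewrite -(sum_finsupp phi finF uF) -(sum_finsupp phi finF vF) u0 v0
  scaler0 addr0.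
Qed.

(** A dependence that is nonzero at a zero [e] of [phi] can be replaced with the
    indicator function of [e]; any other dependence has finite support. *)
Lemma representable_matroidE (V : lmodType k) (phi : E -> V) :
  representable_matroid phi = system_of_dependences (finite_dependences phi).
Proof.
apply/seteqP; split=> X; rewrite /representable_matroid => /independentP SX;
  apply/independentP => c.
  by move=> [Lc _]; exact: SX.
move=> [finc c0] cX.
have loop e : phi e = 0 -> c e = 0.
  move=> phie; apply: contrapT => /eqP ce0.
  pose i x : k := (x == e)%:R.
  have iphi x : i x *: phi x = 0.
    by rewrite /i; have [->|] := eqVneq x e; rewrite ?phie ?scaler0 ?scale0r.
  have : i = cst 0.
    apply: SX.
      split; last first.
        apply: (@sub_finite_set _ _ [set e]) => // x /=.
        by rewrite /i; case: (x =P e) => [->|_]; rewrite ?eqxx.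
      split; last by apply: fsbig1.
      by apply: (@sub_finite_set _ _ set0) => // x /=; rewrite iphi eqxx.
    move=> x nXx; rewrite /i; case: eqVneq => // xe.
    by move: ce0; rewrite -xe cX ?eqxx.
  by move=> /(congr1 (@^~ e)) /= /eqP; rewrite /i eqxx oner_eq0.
apply: SX => //; split=> //=.
apply: sub_finite_set finc => e /= ce; rewrite scaler_eq0 negb_or ce/=.
by apply: contra_neq ce => /loop.
Qed.

Variables (A : Type) (f : E -> (A -> k)).

Lemma finite_dependences_overlineP (c : E -> k) :
  finite_set [set e | c e != 0] ->
  finite_dependences (overline f) c <->
  forall d, thin_dependences f d -> pairing c d = 0.
Proof.
move=> finc.
have c0 e : ~ [set e | c e != 0] e -> c e = 0 by move=> /negP/negPn/eqP.
have sumE (d : set_type (thin_dependences f)) :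
    (\sum_(e \in [set: E]) c e *: overline f e) d = pairing c (\val d).
  rewrite (sum_finsupp _ finc c0) fct_sumE /pairing.
  by rewrite (sum_finsupp (\val d : E -> k^o) finc c0).
split=> [[[_ cf] _] d Dd|cD].
  by rewrite -(sumE (SigSub (mem_set Dd))) cf.
split=> //; split.
  apply: sub_finite_set finc => e /=.
  by apply: contra_neq => ->; rewrite scale0r.
by apply/funext => d; rewrite sumE; apply: cD; exact: set_valP.
Qed.

(** Thinness says that the rows [f^~ a] are finitely supported, so that they
    belong to the space of finite dependences of [overline f]. *)
Lemma thin_dependences_annihilator : thin f ->
  thin_dependences f = annihilator (finite_dependences (overline f)).
Proof.
move=> f_thin; apply/seteqP; split=> d.
  move=> Dd c Lc; have finc := Lc.2.
  exact: (finite_dependences_overlineP finc).1 Lc d Dd.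
have sumE (h : E -> k) a :
    \sum_(e \in [set: E]) h e * f e a = pairing (f^~ a) h.
  by apply: eq_fsbigr => e _; rewrite mulrC.
move=> Ld a; split.
  by apply: sub_finite_set (f_thin a) => e /=; apply: contra_neq => ->;
    rewrite mulr0.
rewrite sumE; apply: Ld; apply/(finite_dependences_overlineP (f_thin a)).
by move=> d' /(_ a)[_]; rewrite sumE.
Qed.

End ThinSums.

Theorem corollary3p4 (k : fieldType) (E : choiceType) (A : Type)
    (f : E -> (A -> k)) (f_thin : thin f) :
  thin_sums_system f = dual (representable_matroid (overline f)) /\
  (is_matroid (thin_sums_system f) /\ cofinitary (thin_sums_system f)).
Proof.
have hL := finite_dependences_subspace (overline f).
have mL := finsupp_subspace_matroid hL.
have tsE : thin_sums_system f = dual (representable_matroid (overline f)).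
  rewrite representable_matroidE -(annihilator_dual hL).
  exact: (congr1 (@system_of_dependences k E) (thin_dependences_annihilator _)).
split=> //; rewrite /cofinitary tsE representable_matroidE; split.
  exact: dual_is_matroid.
by rewrite dual_dual//; exact: finsupp_subspace_finitary.
Qed.
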